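(* There are $2^{\aleph_0}$ (a continuum of) distinct locally finite subvarieties of $\mathbb{V}(\boldsymbol{RN})$ that lack the ES property.
   Context: Heyting algebras are algebras $\langle A;\wedge,\vee,\to,0,1\rangle$. $\boldsymbol{RN}$ is the Rieger–Nishimura lattice, i.e., the free one-generated Heyting algebra, and $\mathbb{V}(\boldsymbol{RN})$ is the variety it generates. A variety is locally finite if its finitely generated members are finite. A homomorphism $f\colon\mathbf{A}\to\mathbf{B}$ in a variety $\mathsf{K}$ is an epimorphism if for all $\mathbf{C}\in\mathsf{K}$ and homomorphisms $g,h\colon\mathbf{B}\to\mathbf{C}$, $g\circ f=h\circ f$ implies $g=h$; $\mathsf{K}$ has the ES property if all its epimorphisms are surjective. *)

(* Defs.v *)
From mathcomp Require Import all_boot all_classical.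

Set Implicit Arguments.
Unset Strict Implicit.
Unset Printing Implicit Defensive.

Local Open Scope classical_set_scope.

Record heyting := Heyting {
  carrier :> Type;
  hmeet : carrier -> carrier -> carrier;
  hjoin : carrier -> carrier -> carrier;
  himp : carrier -> carrier -> carrier;
  hbot : carrier;
  htop : carrier;
  hmeetC : forall x y, hmeet x y = hmeet y x;
  hmeetA : forall x y z, hmeet x (hmeet y z) = hmeet (hmeet x y) z;
  hjoinC : forall x y, hjoin x y = hjoin y x;
  hjoinA : forall x y z, hjoin x (hjoin y z) = hjoin (hjoin x y) z;
  hjoinKI : forall x y, hmeet x (hjoin x y) = x;
  hmeetKU : forall x y, hjoin x (hmeet x y) = x;
  hbotU : forall x, hjoin hbot x = x;
  htopI : forall x, hmeet htop x = x;
  (* residuation: x /\ y <= z iff x <= y -> z, where a <= b means a /\ b = a *)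
  himpP : forall x y z,
    hmeet (hmeet x y) z = hmeet x y <-> hmeet x (himp y z) = x
}.

Arguments hbot {h}.
Arguments htop {h}.

Definition is_hom (A B : heyting) (f : A -> B) : Prop :=
  [/\ forall x y, f (hmeet x y) = hmeet (f x) (f y),
      forall x y, f (hjoin x y) = hjoin (f x) (f y),
      forall x y, f (himp x y) = himp (f x) (f y),
      f hbot = hbot
    & f htop = htop].

Definition subuniverse (A : heyting) (S : set A) : Prop :=
  [/\ forall x y, S x -> S y -> S (hmeet x y),
      forall x y, S x -> S y -> S (hjoin x y),
      forall x y, S x -> S y -> S (himp x y),
      S hbot
    & S htop].

Definition finitely_generated (A : heyting) : Prop :=
  exists2 X : set A, finite_set X &
    forall S : set A, subuniverse S -> X `<=` S -> S = [set: A].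

Definition free_on (A : heyting) (x : A) : Prop :=
  forall (B : heyting) (b : B), exists! f : A -> B, is_hom f /\ f x = b.

Inductive hterm (V : Type) : Type :=
| TVar of V
| TMeet of hterm V & hterm V
| TJoin of hterm V & hterm V
| TImp of hterm V & hterm V
| TBot
| TTop.

Arguments TBot {V}.
Arguments TTop {V}.

Fixpoint heval (V : Type) (A : heyting) (v : V -> A) (t : hterm V) : A :=
  match t with
  | TVar i => v i
  | TMeet s u => hmeet (heval v s) (heval v u)
  | TJoin s u => hjoin (heval v s) (heval v u)
  | TImp s u => himp (heval v s) (heval v u)
  | TBot => hbot
  | TTop => htop
  end.

Definition equation : Type := (hterm nat * hterm nat)%type.

Definition satisfies (A : heyting) (e : equation) : Prop :=
  forall v : nat -> A, heval v e.1 = heval v e.2.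

(* Classes of algebras have type [heyting -> Prop] and not [set heyting]: the
   latter would force the universe of carriers below that of [set], so that
   [set T] could not be the carrier of an algebra. *)
Definition is_variety (K : heyting -> Prop) : Prop :=
  exists E : set equation,
    forall A, K A <-> forall e, E e -> satisfies A e.

Definition subclass (K L : heyting -> Prop) : Prop := forall A, K A -> L A.

Definition variety_gen (A : heyting) : heyting -> Prop :=
  fun B => forall K : heyting -> Prop, is_variety K -> K A -> K B.

Definition locally_finite (K : heyting -> Prop) : Prop :=
  forall A, K A -> finitely_generated A -> finite_set [set: A].

Definition epimorphism (K : heyting -> Prop) (A B : heyting) (f : A -> B) : Prop :=
  is_hom f /\
  forall (C : heyting) (g h : B -> C), K C -> is_hom g -> is_hom h ->
    g \o f = h \o f -> g = h.

Definition ES_property (K : heyting -> Prop) : Prop :=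
  forall (A B : heyting) (f : A -> B), K A -> K B ->
    epimorphism K f -> forall b : B, exists a : A, f a = b.

(* The algebra of one-variable terms modulo the identities of all Heyting
   algebras; it witnesses that [free_on] is inhabited. *)
Section FreeExists.

Let T := hterm unit.

Let equ (s t : T) : Prop :=
  forall (B : heyting) (v : unit -> B), heval v s = heval v t.

Let Q := {c : set T | exists t, c = equ t}.

Let pi (t : T) : Q := exist _ (equ t) (ex_intro _ t erefl).

Let repr (c : Q) : T := sval (cid (svalP c)).

Let ev (B : heyting) (v : unit -> B) (c : Q) : B := heval v (repr c).

Let ev_pi B v t : @ev B v (pi t) = heval v t.
Proof.
rewrite /ev /repr; case: cid => s /= es.
have : equ s t by rewrite -es.
exact.
Qed.

Let ev_inj (c d : Q) : (forall B v, @ev B v c = ev v d) -> c = d.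
Proof.
have reprK x : sval x = equ (repr x) by rewrite /repr; case: cid.
have svalI (x y : Q) : sval x = sval y -> x = y.
  case: x y => [x px] [y py] /= exy; case: y / exy py => py.
  by congr exist; apply: Prop_irrelevance.
move=> cd; apply: svalI.
rewrite !reprK; apply/funext => u; apply/propext; split=> h B v.
- by rewrite -(h B v); apply/esym/cd.
- by rewrite -(h B v); apply: cd.
Qed.

Let qmeet (c d : Q) := pi (TMeet (repr c) (repr d)).
Let qjoin (c d : Q) := pi (TJoin (repr c) (repr d)).
Let qimp (c d : Q) := pi (TImp (repr c) (repr d)).
Let qbot := pi TBot.
Let qtop := pi TTop.

Let ev_meet B v c d : @ev B v (qmeet c d) = hmeet (ev v c) (ev v d).
Proof. exact: ev_pi. Qed.
Let ev_join B v c d : @ev B v (qjoin c d) = hjoin (ev v c) (ev v d).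
Proof. exact: ev_pi. Qed.
Let ev_imp B v c d : @ev B v (qimp c d) = himp (ev v c) (ev v d).
Proof. exact: ev_pi. Qed.
Let ev_bot B v : @ev B v qbot = hbot.
Proof. exact: ev_pi. Qed.
Let ev_top B v : @ev B v qtop = htop.
Proof. exact: ev_pi. Qed.

Let evE := (ev_meet, ev_join, ev_imp, ev_bot, ev_top).

Let qimpP x y z : qmeet (qmeet x y) z = qmeet x y <-> qmeet x (qimp y z) = x.
Proof.
split=> h; apply: ev_inj => B v; rewrite !evE.
- by apply/himpP; rewrite -!ev_meet h.
- by apply/himpP; rewrite -ev_imp -ev_meet h.
Qed.

Let F : heyting.
Proof.
refine (@Heyting Q qmeet qjoin qimp qbot qtop _ _ _ _ _ _ _ _ qimpP);
  move=> *; apply: ev_inj => B v; rewrite !evE.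
- exact: hmeetC.
- exact: hmeetA.
- exact: hjoinC.
- exact: hjoinA.
- exact: hjoinKI.
- exact: hmeetKU.
- exact: hbotU.
- exact: htopI.
Defined.

Lemma free_on_exists : exists (A : heyting) (x : A), free_on x.
Proof.
exists F, (pi (TVar tt)) => B b.
exists (@ev B (fun=> b)); split.
  by split; [split=> *; rewrite evE | rewrite ev_pi].
move=> f [[fM fJ fI f0 f1] fx]; apply/funext => c.
have fpi t : f (pi t) = heval (fun=> b) t.
  elim: t => [[]|s IHs u IHu|s IHs u IHu|s IHs u IHu||] //=.
  - rewrite -IHs -IHu -fM; congr f; apply: ev_inj => D v.
    by rewrite ev_meet !ev_pi.
  - rewrite -IHs -IHu -fJ; congr f; apply: ev_inj => D v.
    by rewrite ev_join !ev_pi.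
  - rewrite -IHs -IHu -fI; congr f; apply: ev_inj => D v.
    by rewrite ev_imp !ev_pi.
rewrite /ev -fpi; congr f; apply: ev_inj => D v; exact: ev_pi.
Qed.

End FreeExists.

(* Main.v *)
Require Import Defs.
From mathcomp Require Import all_boot all_classical zify.

Set Implicit Arguments.
Unset Strict Implicit.
Unset Printing Implicit Defensive.

(* The free one-generated algebra maps onto the upsets of every finite upset of
   the Rieger-Nishimura ladder, the frame on [nat] in which [i] sees the [j]
   with [j = i] or [j + 2 <= i].  Collapsing the top of the ladder yields the
   combs: a stack of [m] two-point antichains above the four-point rooted frame
   [{0, 1, 2, 4}] of the ladder.  No comb is a bounded morphic image of an upset
   of another one (there is nothing above the antichains that would allow one of
   them to be absorbed), and a suitable equation [comb_equation m] fails in the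
   [m]-th comb only.  Hence distinct sets of combs generate distinct varieties.
   These are locally finite, because the upsets of a comb form a linear sum of
   intervals of bounded size.

   If infinitely many combs are used, the variety contains the upsets of the
   infinite ascending stack of antichains [{2n, 2n + 1}].  Sending [2n] and
   [2n - 1] to [n] maps this stack onto the chain of natural numbers, and the
   dual embedding of algebras is not surjective.  It is an epimorphism: two
   different extensions of the same chain would force two occurrences, one above
   the other, of a configuration that a comb contains only once.

   Varieties are determined by their theories, which are subsets of a countable
   set; the theorem follows by Cantor-Bernstein. *)

(** * Kripke frames and their algebras of upsets *)

Record frame := Frame {
  point :> Type;
  sees : rel point;
  sees_refl : reflexive sees;
  sees_trans : transitive sees
}.

Definition upset (W : frame) (U : W -> Prop) : Prop :=
  forall x y, sees x y -> U x -> U y.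

Section UpsetAlgebra.
Variable W : frame.

Definition up_carrier : Type := {U : W -> Prop | upset U}.

Lemma up_eq (U V : up_carrier) : (forall x, sval U x <-> sval V x) -> U = V.
Proof.
case: U V => [U pU] [V pV] /= UV.
have {}UV : U = V by apply/funext => x; apply/propext.
by case: V / UV pV => pV; congr exist; apply: Prop_irrelevance.
Qed.

Definition up_meet (U V : up_carrier) : up_carrier.
Proof.
exists (fun x => sval U x /\ sval V x) => x y xy [Ux Vx].
by split; [apply: (svalP U _ _ xy) | apply: (svalP V _ _ xy)].
Defined.

Definition up_join (U V : up_carrier) : up_carrier.
Proof.
exists (fun x => sval U x \/ sval V x) => x y xy [Ux|Vx].
- by left; apply: (svalP U _ _ xy).
- by right; apply: (svalP V _ _ xy).
Defined.

Definition up_imp (U V : up_carrier) : up_carrier.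
Proof.
exists (fun x => forall y, sees x y -> sval U y -> sval V y) => x y xy UVx z yz.
exact: UVx _ (sees_trans xy yz).
Defined.

Definition up_bot : up_carrier.
Proof. by exists (fun=> False). Defined.

Definition up_top : up_carrier.
Proof. by exists (fun=> True). Defined.

Lemma up_impP U V T :
  up_meet (up_meet U V) T = up_meet U V <-> up_meet U (up_imp V T) = U.
Proof.
split=> e; apply: up_eq => x /=; split; try tauto.
- move=> Ux; split=> // y xy Vy.
  have : sval (up_meet U V) y by split=> //; apply: (svalP U _ _ xy).
  by rewrite -e => -[].
- move=> [Ux Vx]; split=> //.
  move: (Ux); rewrite -e => -[_ /(_ x (sees_refl x))]; exact.
Qed.

Definition up : heyting.
Proof.
refine (@Heyting up_carrier up_meet up_join up_imp up_bot up_top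
  _ _ _ _ _ _ _ _ up_impP);
  by move=> *; apply: up_eq => ? /=; tauto.
Defined.

End UpsetAlgebra.

Section Forcing.
Variables (V : Type) (W : frame).

Fixpoint forces (v : V -> W -> Prop) (t : hterm V) (x : W) : Prop :=
  match t with
  | TVar i => v i x
  | TMeet s u => forces v s x /\ forces v u x
  | TJoin s u => forces v s x \/ forces v u x
  | TImp s u => forall y, sees x y -> forces v s y -> forces v u y
  | TBot => False
  | TTop => True
  end.

Lemma heval_up (v : V -> up W) t x :
  sval (heval v t) x <-> forces (fun i => sval (v i)) t x.
Proof.
elim: t x => //= s IHs u IHu x; rewrite ?IHs ?IHu //.
by split=> H y xy; move: (H y xy); rewrite IHs IHu.
Qed.

End Forcing.

Lemma satisfies_upP (W : frame) (e : equation) :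
  satisfies (up W) e <->
  forall v : nat -> W -> Prop, (forall i, upset (v i)) ->
    forall x, forces v e.1 x <-> forces v e.2 x.
Proof.
split=> [sat v hv x|H v].
- pose v' : nat -> up W := fun i => exist _ (v i) (hv i).
  by rewrite -!(heval_up v') sat.
- by apply: up_eq => x; rewrite !heval_up; apply: H => i; apply: svalP.
Qed.

(** Restricting a condition to the finitely many variables of a term lets one bound serve all of
    them, as in [stack_upset_const]. *)
Fixpoint all_vars (V : Type) (P : V -> Prop) (t : hterm V) : Prop :=
  match t with
  | TVar i => P i
  | TMeet s u | TJoin s u | TImp s u => all_vars P s /\ all_vars P u
  | TBot | TTop => True
  end.

Lemma all_varsT (V : Type) (P : V -> Prop) t : (forall i, P i) -> all_vars P t.
Proof. by move=> hP; elim: t => //=. Qed.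

Lemma sub_all_vars (V : Type) (P Q : V -> Prop) t :
  (forall i, P i -> Q i) -> all_vars P t -> all_vars Q t.
Proof. by move=> PQ; elim: t => //= s IHs u IHu [/IHs ? /IHu]. Qed.

Section Bisimulation.
Variables (V : Type) (W X : frame) (Z : W -> X -> Prop).
Hypothesis forth : forall w x w', Z w x -> sees w w' ->
  exists2 x', sees x x' & Z w' x'.
Hypothesis back : forall w x x', Z w x -> sees x x' ->
  exists2 w', sees w w' & Z w' x'.

Lemma bisim_forces (v : V -> W -> Prop) (v' : V -> X -> Prop) t :
    all_vars (fun i => forall w x, Z w x -> v i w <-> v' i x) t ->
  forall w x, Z w x -> forces v t w <-> forces v' t x.
Proof.
elim: t => [i|s IHs u IHu|s IHs u IHu|s IHs u IHu||] //=.
- by move=> [/IHs hs /IHu hu] w x wx; rewrite (hs _ _ wx) (hu _ _ wx).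
- by move=> [/IHs hs /IHu hu] w x wx; rewrite (hs _ _ wx) (hu _ _ wx).
- move=> [/IHs hs /IHu hu] w x wx; split=> H.
  + move=> x' xx' /= s'; have [w' ww' w'x'] := back wx xx'.
    by apply/(hu _ _ w'x')/H => //; apply/(hs _ _ w'x').
  + move=> w' ww' /= s'; have [x' xx' w'x'] := forth wx ww'.
    by apply/(hu _ _ w'x')/H => //; apply/(hs _ _ w'x').
Qed.

End Bisimulation.

(** * Homomorphisms, theories and models *)

Lemma hom_heval (V : Type) (A B : heyting) (f : A -> B) (v : V -> A) t :
  is_hom f -> f (heval v t) = heval (fun i => f (v i)) t.
Proof. by move=> [fM fJ fI f0 f1]; elim: t => //= s <- u <-. Qed.

Lemma eq_heval (V : Type) (A : heyting) (v w : V -> A) t :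
  v =1 w -> heval v t = heval w t.
Proof. by move=> vw; elim: t => //= s -> u ->. Qed.

Lemma satisfies_sub (A B : heyting) (f : A -> B) e :
  is_hom f -> injective f -> satisfies B e -> satisfies A e.
Proof. by move=> fh fI sB v; apply: fI; rewrite !hom_heval. Qed.

Definition theory (K : heyting -> Prop) : set equation :=
  fun e => forall A, K A -> satisfies A e.

Definition models (E : set equation) : heyting -> Prop :=
  fun A => forall e, E e -> satisfies A e.

Lemma models_variety E : is_variety (models E).
Proof. by exists E. Qed.

Lemma varietyP K : is_variety K -> K = models (theory K).
Proof.
move=> [E KE]; apply/funext => A; apply/propext; split=> [KA e|mA].
  exact.
by apply/KE => e Ee; apply: mA => B /KE; apply.
Qed.

Lemma himp_eqT (A : heyting) (a b : A) : himp a b = htop <-> hmeet a b = a.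
Proof. by have := himpP htop a b; rewrite !htopI => ->. Qed.

(** * The frames of the ladder and of the combs *)

Definition ladder_sees : rel nat := fun i j => (i == j) || (j.+2 <= i).

Lemma ladder_refl : reflexive ladder_sees.
Proof. by move=> i; rewrite /ladder_sees eqxx. Qed.

Lemma ladder_trans : transitive ladder_sees.
Proof. by rewrite /ladder_sees => j i k; lia. Qed.

Definition ladder := Frame ladder_refl ladder_trans.

(* For [i <= m] the points [2i] and [2i + 1] form the [i]-th antichain from the
   top; [2m + 2] lies below [2m] but not below [2m + 1], and all points from
   [2m + 3] on are copies of the root. *)
Definition comb_sees (m : nat) : rel nat := fun i j =>
  [|| i == j, 2 * m + 3 <= i
    | (j %/ 2 < i %/ 2) && ~~ ((i == 2 * m + 2) && (j == 2 * m + 1))].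

Lemma comb_refl m : reflexive (comb_sees m).
Proof. by move=> i; rewrite /comb_sees eqxx. Qed.

Lemma comb_trans m : transitive (comb_sees m).
Proof. by rewrite /comb_sees => j i k; lia. Qed.

Definition comb m := Frame (@comb_refl m) (@comb_trans m).

(** * The ladder is generated by its first point *)

(** If [N] is the greatest element, [U] contains every [k] with [k + 2 <= N], so only [N - 1] is
    undecided. With it [U] is an initial segment, without it the upset generated by [N]. *)
Lemma ladder_upset_shape (U : ladder -> Prop) N :
  upset U -> (forall k, U k -> k < N) ->
  exists n, (forall k, U k <-> k < n) \/
            (forall k, U k <-> k.+1 < n \/ k = n).
Proof.
move=> hU; elim: N => [|N IHN] hN.
  by exists 0; left=> k; split=> // /hN.
have [UN|nUN] := pselect (U N); last first.
  apply: IHN => k Uk; have := hN k Uk.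
  by rewrite ltnS leq_eqVlt => /predU1P[kN|//]; rewrite kN in Uk.
have lo k : k.+1 < N -> U k.
  by move=> kN; apply: hU UN => /=; rewrite /ladder_sees; lia.
have [UN1|nUN1] := pselect (U N.-1).
- exists N.+1; left=> k; split=> [/hN//|]; rewrite ltnS => kN.
  have [->//|/eqP k1] := eqVneq k N; have [->//|/eqP k2] := eqVneq k N.-1.
  by apply: lo; lia.
- exists N; right=> k; split=> [Uk|[/lo//|->//]].
  have := hN k Uk; have [->|/eqP k1] := eqVneq k N; first by right.
  by have [e|/eqP k2 ?] := eqVneq k N.-1; [rewrite e in Uk|left; lia].
Qed.

Section LadderGenerated.
Variables (A : heyting) (f : A -> up ladder) (x : A).
Hypotheses (fh : is_hom f) (fx : forall k, sval (f x) k <-> k = 0).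

(** The Rieger-Nishimura recursion: the segment below [n] joined with the upset generated by [n] is
    the next segment, and the points that do not see [n] form the upset generated by [n + 1]. The
    latter is an implication into the segment below [n - 1], which the induction therefore carries
    along. *)
Lemma ladder_generated n :
  (exists a, forall k, sval (f a) k <-> k < n) /\
  (exists a, forall k, sval (f a) k <-> k.+1 < n \/ k = n).
Proof.
case: (fh) => _ fJ fI f0 _.
suff : [/\ exists a, forall k, sval (f a) k <-> k < n.-1,
  exists a, forall k, sval (f a) k <-> k < n &
  exists a, forall k, sval (f a) k <-> k.+1 < n \/ k = n] by case.
elim: n => [|n [[a ha] [b hb] [c hc]]].
  split; [by exists hbot => k; rewrite f0..|].
  by exists x => k; rewrite fx; split=> [->|[]//]; right.
split; first by exists b.
- exists (hjoin b c) => k; rewrite fJ /= hb hc; split; first by case; lia.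
  by have [->|] := eqVneq k n; [right; right|left; lia].
- exists (himp c a) => k; rewrite fI /=; split=> [H|hk y].
  + apply: contrapT => nk; have : ladder_sees k n by rewrite /ladder_sees; lia.
    by move=> /H /=; rewrite hc ha; lia.
  + by rewrite hc ha /ladder_sees; lia.
Qed.

Lemma ladder_bounded_range (U : ladder -> Prop) N :
  upset U -> (forall k, U k -> k < N) -> exists a, forall k, sval (f a) k <-> U k.
Proof.
move=> hU hN; have [n [H|H]] := ladder_upset_shape hU hN;
  have [[a ha] [b hb]] := ladder_generated n; [exists a|exists b] => k.
- by rewrite ha H.
- by rewrite hb H.
Qed.

End LadderGenerated.

(** * The combs belong to the variety of the ladder *)

(* The bounded morphism from the upset of [3m + 4] in the ladder to the comb: the
   triple [3i, 3i + 1, 3i + 2] collapses to the [i]-th antichain, [3i + 2] being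
   identified with [3i]. *)
Definition ladder_comb (m k j : nat) : Prop :=
  (k < 3 * m /\ j = 2 * (k %/ 3) + (k %% 3 == 1)) \/
  (3 * m <= k <= 3 * m + 2 /\ j + m = k) \/
  (k = 3 * m + 4 /\ 2 * m + 3 <= j).

Lemma ladder_comb_forth m k j k' : ladder_comb m k j -> ladder_sees k k' ->
  exists2 j', comb_sees m j j' & ladder_comb m k' j'.
Proof.
move=> kj kk'; have [<-|nk] := eqVneq k k'; first by exists j; [exact: comb_refl|].
have {kk'}lk : k'.+2 <= k by move: kk'; rewrite /ladder_sees; lia.
have [h|h] := ltnP k' (3 * m).
- exists (2 * (k' %/ 3) + (k' %% 3 == 1)); last by left.
  by move: kj; rewrite /ladder_comb /comb_sees; lia.
- exists (k' - m); last by right; left; move: kj; rewrite /ladder_comb; lia.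
  by move: kj; rewrite /ladder_comb /comb_sees; lia.
Qed.

Lemma ladder_comb_back m k j j' : ladder_comb m k j -> comb_sees m j j' ->
  exists2 k', ladder_sees k k' & ladder_comb m k' j'.
Proof.
move=> kj jj'; have [<-|nk] := eqVneq j j'; first by exists k; [exact: ladder_refl|].
have [h|h] := ltnP j' (2 * m).
- exists (3 * (j' %/ 2) + j' %% 2); last by rewrite /ladder_comb; lia.
  by move: kj jj'; rewrite /ladder_comb /comb_sees /ladder_sees; lia.
have [h'|h'] := ltnP j' (2 * m + 3).
- exists (j' + m); last by rewrite /ladder_comb; lia.
  by move: kj jj'; rewrite /ladder_comb /comb_sees /ladder_sees; lia.
- exists (3 * m + 4); last by rewrite /ladder_comb; lia.
  by move: kj jj'; rewrite /ladder_comb /comb_sees /ladder_sees; lia.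
Qed.

Lemma ladder_comb_total m j : exists k, ladder_comb m k j.
Proof.
have [h|h] := ltnP j (2 * m).
  by exists (3 * (j %/ 2) + j %% 2); rewrite /ladder_comb; lia.
have [h'|h'] := ltnP j (2 * m + 3).
  by exists (j + m); rewrite /ladder_comb; lia.
by exists (3 * m + 4); rewrite /ladder_comb; lia.
Qed.

(** A valuation on the comb is pulled back along [ladder_comb] to finite upsets of the ladder. These
    lie in the range of the homomorphism sending the generator to the upset of the point 0, so
    equations of [RN] transfer. *)
Lemma RN_satisfies_comb (RN : heyting) (x : RN) m e :
  free_on x -> satisfies RN e -> satisfies (up (comb m)) e.
Proof.
move=> RN_free sat; apply/satisfies_upP => w hw j.
have h0 : @upset ladder (fun k => k = 0).
  by move=> i k /=; rewrite /ladder_sees; lia.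
have [f [[fh fx] _]] := RN_free (up ladder) (exist _ _ h0).
pose v i (k : ladder) := exists2 j, ladder_comb m k j & w i j.
(* Only [3 * m + 4] is matched with several [j], the copies of the root; they see each other, so no
   upset tells them apart. *)
have vE i k j' : ladder_comb m k j' -> v i k <-> w i j'.
  move=> kj'; split=> [[j1 kj1]|]; last by exists j'.
  by apply: hw => /=; move: kj' kj1; rewrite /ladder_comb /comb_sees; lia.
have hv i : upset (v i).
  move=> k k' kk' [j1 kj1 wj1]; have [j2 j12 kj2] := ladder_comb_forth kj1 kk'.
  by exists j2 => //; apply: hw wj1.
have bv i k : v i k -> k < 3 * m + 5.
  by case=> j1; rewrite /ladder_comb; lia.
have f0 k : sval (f x) k <-> k = 0 by rewrite fx.
have [r hr] := choice (fun i => ladder_bounded_range fh f0 (hv i) (bv i)).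
have ev t : forall k, sval (f (heval r t)) k <-> forces v t k.
  move=> k; rewrite hom_heval // heval_up.
  suff -> : (fun i => sval (f (r i))) = v by [].
  by apply/funext => i; apply/funext => l; apply/propext.
have [k kj] := ladder_comb_total m j.
have bis t := @bisim_forces _ ladder (comb m) _
  (@ladder_comb_forth m) (@ladder_comb_back m) v w t
  (all_varsT _ (fun i k j => @vE i k j)) _ _ kj.
by rewrite -!bis -!ev sat.
Qed.

(** * Equations separating the combs *)

Section SeparatingTerm.
Variable n : nat.

Let u i : hterm nat := TVar (2 * i).
Let w i : hterm nat := TVar (2 * i + 1).

(** Intended to be the upset consisting of the first [i] antichains. *)
Definition layer (i : nat) : hterm nat :=
  if i is i'.+1 then TJoin (TVar (2 * i')) (TVar (2 * i' + 1)) else TBot.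

Definition tiff V (s t : hterm V) := TMeet (TImp s t) (TImp t s).

Definition fork_half i := TMeet (tiff (TMeet (u i) (w i)) (layer i))
                                (tiff (TImp (u i) (layer i)) (w i)).

Definition fork i := TMeet (fork_half i) (tiff (TImp (w i) (layer i)) (u i)).

Fixpoint forks k : hterm nat :=
  if k is k'.+1 then TMeet (forks k') (fork k') else TTop.

(* The premises make [u i] and [w i] split the [i]-th antichain for [i < n]. The
   conclusion fails exactly at a point seeing both a point of [w n] outside of
   [layer n] and a point outside of [u n] that sees no such point. *)
Definition comb_term : hterm nat :=
  let u' := TImp (w n) (layer n) in
  TImp (TMeet (forks n) (fork_half n)) (TJoin (TImp u' (u n)) u').

End SeparatingTerm.

Lemma forces_meet (W : frame) (v : nat -> W -> Prop) s t x :
  forces v (TMeet s t) x <-> forces v s x /\ forces v t x.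
Proof. by []. Qed.

Lemma forces_tiff (W : frame) (v : nat -> W -> Prop) s t x :
  forces v (tiff s t) x <->
  forall y, sees x y -> forces v s y <-> forces v t y.
Proof.
split=> [[/= h1 h2] y xy|h]; first by split; [exact: h1|exact: h2].
by split=> y /h[].
Qed.

Section ForcesFork.
Variables (W : frame) (v : nat -> W -> Prop) (i : nat) (x : W).
Let u := v (2 * i).
Let w := v (2 * i + 1).
Let d := forces v (layer i).

Lemma forces_fork_half : forces v (fork_half i) x <->
  forall y, sees x y -> ((u y /\ w y) <-> d y) /\
    ((forall z, sees y z -> u z -> d z) <-> w y).
Proof.
rewrite /fork_half forces_meet !forces_tiff; split=> [[h1 h2] y xy|h].
  by split; [apply: h1|apply: h2].
by split=> y /h[].
Qed.

Lemma forces_fork : forces v (fork i) x <->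
  forces v (fork_half i) x /\
  (forall y, sees x y -> (forall z, sees y z -> w z -> d z) <-> u y).
Proof. by rewrite /fork forces_meet forces_tiff. Qed.

End ForcesFork.

Lemma forces_forks (W : frame) (v : nat -> W -> Prop) k x :
  forces v (forks k) x <-> forall i, i < k -> forces v (fork i) x.
Proof.
elim: k => [|k IHk] //=; split=> [[/IHk h hk] i|h].
  by rewrite ltnS leq_eqVlt => /predU1P[->//|]; apply: h.
by split; [apply/IHk => i ik|]; apply: h; lia.
Qed.

Definition comb_equation n : equation := (comb_term n, TTop).

(** The variables name the points of the antichains. The conclusion fails at the root: [2 * n + 2]
    sees no point of [w n] outside of [layer n] and is not in [u n], while the root sees
    [2 * n + 1]. Because of the point [2 * n + 2] the last premise is only half of a fork. *)
Lemma comb_not_satisfies n : ~ satisfies (up (comb n)) (comb_equation n).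
Proof.
rewrite satisfies_upP => H.
(* The bound on [i] makes all other variables empty; for them the second condition need not define
   an upset. *)
pose v i (k : comb n) := i < 2 * n + 2 /\ (k < 2 * (i %/ 2) \/ k = i).
have hv i : upset (v i).
  by move=> k l /=; rewrite /comb_sees /v; lia.
have lay i k : i <= n -> forces v (layer i) k <-> k < 2 * i.
  by case: i => [|i] /= hi; rewrite /v; [lia|split; lia].
have uE i k : i <= n -> v (2 * i) k <-> k < 2 * i \/ k = 2 * i.
  by rewrite /v; split; lia.
have wE i k : i <= n -> v (2 * i + 1) k <-> k < 2 * i \/ k = 2 * i + 1.
  by rewrite /v; split; lia.
have half i : i <= n -> forces v (fork_half i) (2 * n + 3).
  move=> hi; apply/forces_fork_half => y _; split.
    by rewrite lay //= uE // wE //; lia.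
  rewrite /= wE //; split=> [h|h z yz]; last first.
    by rewrite lay // uE //; move: yz; rewrite /= /comb_sees; lia.
  apply: contrapT => ny.
  have : sees (y : comb n) (2 * i) by rewrite /= /comb_sees; lia.
  by move=> /h; rewrite lay // uE //; lia.
have full i : i < n -> forces v (fork i) (2 * n + 3).
  move=> hi; apply/forces_fork; split; first by apply: half; lia.
  have hi' : i <= n by lia.
  move=> y _.
  rewrite /= uE //; split=> [h|h z yz]; last first.
    by rewrite lay // wE //; move: yz; rewrite /= /comb_sees; lia.
  apply: contrapT => ny.
  have : sees (y : comb n) (2 * i + 1) by rewrite /= /comb_sees; lia.
  by move=> /h; rewrite lay // wE //; lia.
have /(_ I) := (H v hv (2 * n + 3)).2.
have root y : @sees (comb n) (2 * n + 3) y by rewrite /= /comb_sees; lia.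
move=> /= /(_ (2 * n + 3) (root _)) [|h|h].
- by split; [apply/forces_forks|apply: half].
- have := h (2 * n + 2) (root _); rewrite uE // => H1.
  suff : 2 * n + 2 < 2 * n \/ 2 * n + 2 = 2 * n by lia.
  apply: H1 => y yz; rewrite lay // wE //; move: yz; rewrite /comb_sees; lia.
- by have := h (2 * n + 1) (root _); rewrite lay // wE //; lia.
Qed.

(** The last two cases are the single place where different layers contain incomparable points; the
    separating equations and the uniqueness equation both work by locating it. *)
Lemma comb_incomparable m i j : ~~ comb_sees m i j -> ~~ comb_sees m j i ->
  [\/ [/\ i %/ 2 = j %/ 2, i <> j & i < 2 * m + 2],
      i = 2 * m + 1 /\ j = 2 * m + 2 | i = 2 * m + 2 /\ j = 2 * m + 1].
Proof.
rewrite /comb_sees => ij ji.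
have [e|ne] := eqVneq (i %/ 2) (j %/ 2).
  by apply: Or31; split; lia.
by have [l|l] := leqP i j; [apply: Or32|apply: Or33]; split; lia.
Qed.

(** A failure yields [s] properly seeing [q], both incomparable to [r]. This forces [q = 2 * m] and
    [r = 2 * m + 1] and places [z] at the root. The premises then identify the layers up to [n] with
    the first antichains of the comb, which gives [n <= m] and finally excludes [n < m]. *)
Lemma comb_satisfies m n : m <> n -> satisfies (up (comb m)) (comb_equation n).
Proof.
move=> mn; apply/satisfies_upP => v hv x0; split=> // _.
move=> z _ [/forces_forks hf /forces_fork_half hn].
pose U i (k : comb m) := v (2 * i) k; pose W i (k : comb m) := v (2 * i + 1) k.
pose D i (k : comb m) := forces v (layer i) k.
apply: contrapT => /not_orP[].
move=> /existsNP[s /not_implyP[zs /not_implyP[s1 sU]]].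
move=> /existsNP[r /not_implyP[zr /not_implyP[rW rD]]].
have hn1 y : sees z y -> U n y /\ W n y <-> D n y by move=> /hn[].
have hn2 y : sees z y -> (forall k, sees y k -> U n k -> D n k) <-> W n y.
  by move=> /hn[].
have DU y : sees z y -> D n y -> U n y by move=> zy /(hn1 _ zy)[].
have sW : ~ W n s by move=> h; apply/sU/(DU s zs)/s1 => //; apply: sees_refl.
have [q [sq [qU qD]]] : exists q, sees s q /\ U n q /\ ~ D n q.
  move/(hn2 _ zs): sW => /existsNP[q /not_implyP[sq /not_implyP[qU qD]]].
  by exists q.
have zq := sees_trans zs sq.
have rs : ~~ sees r s by apply/negP => /(hv _ _ _)/(_ rW).
have sr : ~~ sees s r by apply/negP => h; apply/rD/(s1 r).
have rq : ~~ sees r q.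
  by apply/negP => h; apply/qD/hn1 => //; split=> //; apply: hv h rW.
have qr : ~~ sees q r by apply/negP => h; apply: (negP sr); apply: sees_trans h.
have sq' : s <> q by move=> e; apply: sU; rewrite e.
have [rE qE zE] : [/\ r = 2 * m + 1, q = 2 * m & 2 * m + 3 <= z].
  have [qE rE] : q = 2 * m /\ r = 2 * m + 1.
    move: sq; rewrite /= /comb_sees.
    by case: (comb_incomparable rs sr) => [[a b c]|[a b]|[a b]];
      case: (comb_incomparable rq qr) => [[d e f]|[d e]|[d e]]; lia.
  by split=> //; move: zr zq rq qr; rewrite /= /comb_sees; lia.
have zT y : sees z y by rewrite /= /comb_sees zE orbT.
clear rs sr rq qr sq sq' zs zr zq zE.
have fk i : i < n -> [/\ forall y, U i y /\ W i y <-> D i y,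
    forall y, (forall k, sees y k -> U i k -> D i k) <-> W i y
  & forall y, (forall k, sees y k -> W i k -> D i k) <-> U i y].
  move=> /hf /forces_fork[/forces_fork_half h1 h2].
  by split=> y; [apply: (h1 y _).1|apply: (h1 y _).2|apply: h2].
have DE i : D i.+1 = (fun y => U i y \/ W i y) by [].
have Dmono i k : i <= k <= n -> forall y, D i y -> D k y.
  elim: k => [|k IHk] ik y Dy.
    by have -> : 0 = i by lia.
  have [e|ne] := eqVneq i k.+1; first by rewrite -e.
  have [h1 _ _] := fk k ltac:(lia).
  by rewrite DE; left; apply: ((h1 y).2 (IHk _ y Dy)).1; lia.
have cover i (y : nat) : i <= m -> (forall k, D i k <-> k < 2 * i) ->
    (forall y, (forall k, sees y k -> U i k -> D i k) <-> W i y) ->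
    y %/ 2 = i -> U i y \/ W i y.
  move=> im Di h yi; have [|nU] := pselect (U i y); first by left.
  right; apply/h => k yk Uk; apply/Di.
  have : k <> y by move=> e; rewrite -e in nU.
  by move: yk; rewrite /= /comb_sees; lia.
have hU i k l : sees k l -> U i k -> U i l by apply: hv.
have hW i k l : sees k l -> W i k -> W i l by apply: hv.
have DiE i : i <= n -> i <= m /\ forall k, D i k <-> k < 2 * i.
  elim: i => [|i IHi] hi; first by split=> // k; split=> //; rewrite ltn0.
  have {IHi} [im Di] := IHi (ltnW hi); have [h1 h2 h3] := fk i hi.
  have ci y := cover i y im Di h2.
  have Dn y : U i y \/ W i y -> D n y by apply: (Dmono i.+1 n); lia.
  (* Otherwise [q] would lie in the [i]-th antichain, hence in [D i.+1] and in [D n]. *)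
  have {}im : i < m.
    rewrite ltn_neqAle im andbT; apply/eqP => e.
    by apply/qD/Dn/ci; lia.
  split=> //.
  have seem k l : 2 * i + 2 <= k -> l < 2 * i + 2 -> @sees (comb m) k l.
    by rewrite /= /comb_sees; lia.
  have low k : k < 2 * i -> U i k by move=> /Di /h1[].
  have nD k : 2 * i <= k -> ~ D i k by rewrite Di; lia.
  (* If [U i] contained the whole antichain, [W i] could not leave [D i], and the fork would put
     every point, in particular [q], into [U i]. *)
  have notU : ~ (U i (2 * i) /\ U i (2 * i + 1)).
    move=> [U0 U1]; apply/qD/Dn; left; apply/h3 => k _ Wk.
    apply: contrapT => nDk; have [hk|hk] := ltnP k (2 * i); first by apply/nDk/Di.
    suff /(nD _ (leqnn _)) : D i (2 * i) by [].
    have [hk'|hk'] := ltnP k (2 * i + 2); last first.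
      by apply/h1; split=> //; apply: hW Wk; apply: seem; lia.
    exfalso; apply/nDk/h1; split=> //.
    by have [->|ne] := eqVneq k (2 * i); last have -> : k = 2 * i + 1 by lia.
  have notW : ~ (W i (2 * i) /\ W i (2 * i + 1)).
    move=> [W0 W1]; apply/qD/Dn; right; apply/h2 => k _ Uk.
    apply: contrapT => nDk; have [hk|hk] := ltnP k (2 * i); first by apply/nDk/Di.
    suff /(nD _ (leqnn _)) : D i (2 * i) by [].
    have [hk'|hk'] := ltnP k (2 * i + 2); last first.
      by apply/h1; split=> //; apply: hU Uk; apply: seem; lia.
    exfalso; apply/nDk/h1; split=> //.
    by have [->|ne] := eqVneq k (2 * i); last have -> : k = 2 * i + 1 by lia.
  move=> k; rewrite DE; split=> [UW|hk].
  + rewrite ltnNge; apply/negP => hk.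
    have s0 := seem k (2 * i) ltac:(lia) ltac:(lia).
    have s1' := seem k (2 * i + 1) ltac:(lia) ltac:(lia).
    by case: UW => h; [apply: notU|apply: notW]; split;
      [exact: hU s0 h|exact: hU s1' h|exact: hW s0 h|exact: hW s1' h].
  + have [/low|hk'] := ltnP k (2 * i); [by left|by apply: ci; lia].
have [nm Dn] := DiE n (leqnn n).
have seem l : l < 2 * n + 2 -> @sees (comb m) q l /\ @sees (comb m) r l.
  by rewrite /= /comb_sees; lia.
(* As [n < m], both [q] and [r] see [2 * n], which is thus in [U n] and in [W n], but not in
   [D n]. *)
have [q0 r0] := seem (2 * n) ltac:(lia).
suff /Dn : D n (2 * n) by rewrite ltnn.
by apply/hn1 => //; split; [apply: hU q0 qU|apply: hW r0 rW].
Qed.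

Local Open Scope classical_set_scope.

(** * Local finiteness *)

Fixpoint tmap (V V' : Type) (f : V -> V') (t : hterm V) : hterm V' :=
  match t with
  | TVar i => TVar (f i)
  | TMeet s u => TMeet (tmap f s) (tmap f u)
  | TJoin s u => TJoin (tmap f s) (tmap f u)
  | TImp s u => TImp (tmap f s) (tmap f u)
  | TBot => TBot
  | TTop => TTop
  end.

Lemma heval_tmap (V V' : Type) (A : heyting) (f : V -> V') (v : V' -> A) t :
  heval v (tmap f t) = heval (fun i => v (f i)) t.
Proof. by elim: t => //= s -> u ->. Qed.

Lemma fg_terms (A : heyting) : finitely_generated A ->
  exists (k : nat) (a : 'I_k -> A), forall b, exists t, b = heval a t.
Proof.
move=> [X [n /card_esym/card_bijP[f [g fK gK]]] genX].
exists n; pose a (i : 'I_n) : A := val (f (exist _ (val i) (mem_set (ltn_ord i)))).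
exists a => b.
pose S : set A := fun b => exists t, b = heval a t.
suff ST : S = setT by have : S b by rewrite ST.

have Sop op (opt : hterm 'I_n -> hterm 'I_n -> hterm 'I_n) :
    (forall s t, heval a (opt s t) = op (heval a s) (heval a t)) ->
    forall x y, S x -> S y -> S (op x y).
  by move=> h _ _ [s ->] [t ->]; exists (opt s t).
apply: genX => [|x Xx].
  split; [exact: (Sop _ (@TMeet _))|exact: (Sop _ (@TJoin _))|
          exact: (Sop _ (@TImp _))|by exists TBot|by exists TTop].
have := gK (exist _ x (mem_set Xx)); case: (g _) => i /= hi.
have hi' : i < n by exact: set_mem hi.
move=> e; exists (TVar (Ordinal hi')) => /=; rewrite /a /=.
transitivity (sval (f (exist _ i hi))); first by rewrite e.
by congr (sval (f (exist _ i _))); apply: Prop_irrelevance.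
Qed.

Section FiniteSignature.
Variables (T : finType).

(** Arbitrary interpretations of the signature on [T], subject to no laws; there are finitely
    many. *)
Definition ops :=
  ({ffun T * T -> T} * {ffun T * T -> T} * {ffun T * T -> T} * T * T)%type.

Fixpoint peval (V : Type) (M : ops) (c : V -> T) (t : hterm V) : T :=
  let: (mt, jn, im, b, p) := M in
  match t with
  | TVar i => c i
  | TMeet s u => mt (peval M c s, peval M c u)
  | TJoin s u => jn (peval M c s, peval M c u)
  | TImp s u => im (peval M c s, peval M c u)
  | TBot => b
  | TTop => p
  end.

Definition signature k (t : hterm 'I_k) : {ffun (ops * {ffun 'I_k -> T}) -> T} :=
  [ffun x => peval x.1 (x.2 : {ffun _ -> _}) t].

(** The operations of the subalgebra [range dec] lift along [dec], by choice, to operations on [T].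
    Hence it is an image of one of the structures inspected by [signature]. *)
Lemma signature_heval (A : heyting) (dec : T -> A) k (v : 'I_k -> A) s t :
  subuniverse (range dec) -> (forall i, range dec (v i)) ->
  signature s = signature t -> heval v s = heval v t.
Proof.
move=> [hM hJ hI h0 h1] hv st.
have op2 (f : A -> A -> A) :
    (forall x y, range dec x -> range dec y -> range dec (f x y)) ->
    exists g : {ffun T * T -> T}, forall x y, dec (g (x, y)) = f (dec x) (dec y).
  move=> hf.
  have [g hg] : {g : T * T -> T & forall p, dec (g p) = f (dec p.1) (dec p.2)}.
    apply: (@choice _ _ (fun p q => dec q = f (dec p.1) (dec p.2))) => -[x y] /=.
    have [|z _ <-] := hf (dec x) (dec y) (ex_intro2 _ _ x I erefl).
      by exists y.
    by exists z.
  by exists (finfun g) => x y; rewrite ffunE hg.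
have [mt hmt] := op2 _ hM; have [jn hjn] := op2 _ hJ; have [im him] := op2 _ hI.
have [b _ hb] := h0; have [p _ hp] := h1.
have [c hc] : {c : 'I_k -> T & forall i, dec (c i) = v i}.
  by apply: (@choice _ _ (fun i q => dec q = v i)) => i;
    have [z _ <-] := hv i; exists z.
pose M : ops := (mt, jn, im, b, p).
have ev r : heval v r = dec (peval M (finfun c) r).
  by elim: r => /= [i|r -> q ->|r -> q ->|r -> q ->||] //; rewrite ffunE hc.
by rewrite !ev; move/ffunP: st => /(_ (M, finfun c)); rewrite !ffunE => ->.
Qed.

End FiniteSignature.

(** The type [T] depends on the number [k] of generators but not on [i]. Terms with equal signatures
    agree in all [D i] with [P i], hence in [A], so the elements of [A] inject into the
    signatures. *)
Lemma models_locally_finite (I : Type) (D : I -> heyting) (P : I -> Prop) :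
  (forall k, exists T : finType, forall i (v : 'I_k -> D i), P i ->
     exists2 dec : T -> D i, subuniverse (range dec) &
       forall j, range dec (v j)) ->
  locally_finite (models (fun e => forall i, P i -> satisfies (D i) e)).
Proof.
move=> hD A mA /fg_terms[k [a ha]]; have [T hT] := hD k.
have key (s t : hterm 'I_k) :
    signature T s = signature T t -> heval a s = heval a t.
  move=> st; have := mA (tmap val s, tmap val t).
  have h : forall i, P i -> satisfies (D i) (tmap val s, tmap val t).
    move=> i Pi v /=; rewrite !heval_tmap.
    have [dec dec_sub dec_v] := hT i (fun j => v (val j)) Pi.
    exact: signature_heval dec_sub dec_v st.
  move=> /(_ h)/(_ (fun n => if insub n is Some i then a i else hbot)) /=.
  rewrite !heval_tmap /=.
  have e : (fun i : 'I_k => if insub (val i) is Some j then a j else hbot) =1 a.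
    by move=> i; rewrite valK.
  by rewrite !(eq_heval _ e).
have [r hr] := choice ha.
pose F b := signature T (r b).
have FI : injective F by move=> b c /key; rewrite -!hr.
rewrite -(preimage_setT F); apply: finite_preimage.
  by move=> b c _ _; exact: FI.
exact: finite_finset.
Qed.

(** * Finite subalgebras of the algebra of a comb *)

Section CombCuts.
Variable m : nat.
Implicit Types U V : comb m -> Prop.

(* A point outside of a cut sees the whole cut, so that the upsets of the comb
   form a linear sum of the intervals between consecutive cuts. *)
Definition cut (d : nat) (p : comb m) : Prop := p < 2 * d \/ m < d.

Definition between (d : nat) U : Prop :=
  (forall p, cut d p -> U p) /\ (forall p, U p -> cut d.+1 p).

Lemma cut_sees d z p : ~ cut d z -> cut d p -> sees z p.
Proof. by rewrite /cut /= /comb_sees; lia. Qed.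

Lemma cut_mono d d' p : d <= d' -> cut d p -> cut d' p.
Proof. by rewrite /cut; lia. Qed.

(** Take the greatest cut inside [U]: a point of [U] outside of the next cut would see all of that
    cut. *)
Lemma between_exists U : upset U -> exists2 d, d <= m & between d U.
Proof.
move=> hU; pose Q d := `[< forall p, cut d p -> U p >] && (d <= m).
have exQ : exists d, Q d.
  by exists 0; rewrite /Q andbT; apply/asboolP => p; rewrite /cut; lia.
have bQ d : Q d -> d <= m by case/andP.
case: (ex_maxnP exQ bQ) => d /andP[/asboolP dU dm] dmax.
exists d => //; split=> // p Up; apply: contrapT => np.
have {}dm : d < m by move: np; rewrite /cut; lia.
suff /dmax : Q d.+1 by rewrite ltnn.
apply/andP; split=> //; apply/asboolP => q cq.
by apply: hU Up; apply: cut_sees cq.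
Qed.

Lemma between_sub d d' U V : d < d' -> between d U -> between d' V ->
  forall p, U p -> V p.
Proof. by move=> dd' [_ h] [h' _] p /h /(cut_mono dd') /h'. Qed.

Definition imp U V : comb m -> Prop := fun x => forall y, sees x y -> U y -> V y.

(** No interval beyond those of the arguments arises. A point of [U] outside of [V] that lies in a
    cut confines the implication to this cut, since every point outside of the cut sees it. *)
Lemma between_imp d d' U V : upset U -> upset V ->
  d <= m -> d' <= m -> between d U -> between d' V ->
  [\/ forall x, imp U V x, between d (imp U V) | between d' (imp U V)].
Proof.
move=> hU hV dm d'm [U1 U2] [V1 V2].
have VI p : V p -> imp U V p by move=> Vp y py _; apply: hV Vp.
have [UV|nUV] := pselect (forall p, U p -> V p).
  by apply: Or31 => x y _; apply: UV.
have inside e q : cut e q -> U q -> ~ V q -> forall p, imp U V p -> cut e p.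
  move=> cq Uq nVq p ip; apply: contrapT => ncp; apply/nVq/ip => //.
  exact: cut_sees cq.
have same : (forall p, cut d p -> V p) -> between d (imp U V).
  move=> Vd; split=> [p /Vd /VI//|].
  move: nUV => /existsNP[q /not_implyP[Uq nVq]].
  exact: inside (U2 _ Uq) Uq nVq.
have [dd'|d'd] := leqP d d'; first by apply/Or32/same => p /(cut_mono dd') /V1.
have [/same|nV] := pselect (forall p, cut d p -> V p); first by apply: Or32.
apply: Or33; split=> [p /V1 /VI//|].
have [Vd'|] := pselect (forall p, cut d'.+1 p -> V p); last first.
  move=> /existsNP[q /not_implyP[cq nVq]].
  by apply: (inside _ _ cq _ nVq); apply/U1/(cut_mono d'd).
move: nV => /existsNP[q /not_implyP[cq nVq]].
(* Here [V] is the cut [d'.+1] and [U] contains the next cut. *)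
have d1 : d'.+1 < d.
  rewrite ltn_neqAle d'd andbT; apply/eqP => e; apply: nVq; apply: Vd'.
  by rewrite e.
move=> p ip; apply: contrapT => ncp.
have nVp : ~ V p by move=> /V2.
have : cut d'.+2 (2 * d'.+1) by rewrite /cut; lia.
have : ~ V (2 * d'.+1) by move=> /V2; rewrite /cut; lia.
have [cp|ncp2] := pselect (cut d'.+2 p).
  by move=> _ _; apply/nVp/(ip p (sees_refl p))/U1/(cut_mono d1).
move=> nV2 c2; apply/nV2/ip; first exact: cut_sees c2.
by apply/U1/(cut_mono d1).
Qed.

(** Up to mutual visibility there are at most four points between consecutive cuts: two for [d < m],
    and for [d = m] the points [2 * m], [2 * m + 1], [2 * m + 2] and the root, all of whose copies
    [minn] sends to 3. *)
Definition code (d : nat) (c : {ffun 'I_4 -> bool}) (p : comb m) : Prop :=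
  cut d p \/ cut d.+1 p /\ c (inord (minn (p - 2 * d) 3)).

Lemma codeP d U : upset U -> d <= m -> between d U ->
  exists c, forall p, U p <-> code d c p.
Proof.
move=> hU dm [U1 U2]; exists [ffun i : 'I_4 => `[< U (2 * d + i) >]] => p.
rewrite /code ffunE inordK; last by lia.
have [cp|ncp] := pselect (cut d p); first by split=> _; [left|apply: U1].
have [cp|ncp'] := pselect (cut d.+1 p); last by split=> [/U2//|[//|[]//]].
suff UE : U p <-> U (2 * d + minn (p - 2 * d) 3).
  by rewrite UE; split=> [h|[//|[_ /asboolP]//]]; right; split=> //; apply/asboolP.
have s1 : @sees (comb m) p (2 * d + minn (p - 2 * d) 3).
  by move: ncp cp; rewrite /cut /= /comb_sees; lia.
have s2 : @sees (comb m) (2 * d + minn (p - 2 * d) 3) p.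
  by move: ncp cp; rewrite /cut /= /comb_sees; lia.
by split; apply: hU.
Qed.

(** Top, bottom and all upsets in the intervals of the generators form a subalgebra: upsets from
    distinct intervals are comparable, and [between_imp] handles implication. The type of codes does
    not depend on [m]. *)
Lemma comb_finite_subalgebra k (v : 'I_k -> up (comb m)) :
  exists2 dec : bool + 'I_k * {ffun 'I_4 -> bool} -> up (comb m),
    subuniverse (range dec) & forall j, range dec (v j).
Proof.
have [l hl] : {l : 'I_k -> nat & forall j, l j <= m /\ between (l j) (sval (v j))}.
  apply: (@choice _ _ (fun j d => d <= m /\ between d (sval (v j)))) => j.
  by have [d] := between_exists (svalP (v j)); exists d.
(* Codes that do not describe an upset decode to [htop]. *)
pose dec (x : bool + 'I_k * {ffun 'I_4 -> bool}) : up (comb m) :=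
  match x with
  | inl b => if b then htop else hbot
  | inr (j, c) => if pselect (upset (code (l j) c)) is left h
                  then exist _ _ h else htop
  end.
have rtop : range dec htop by exists (inl true).
have rbot : range dec hbot by exists (inl false).
have rb j (U : up (comb m)) : between (l j) (sval U) -> range dec U.
  move=> bU; have [c hc] := codeP (svalP U) (hl j).1 bU.
  exists (inr (j, c)) => //=; case: pselect => [h|[]].
    by apply: up_eq => p /=; rewrite hc.
  by move=> p q pq /hc Up; apply/hc; apply: (svalP U) Up.
have dec_cases (U : up (comb m)) : range dec U ->
    [\/ U = htop, U = hbot | exists j, between (l j) (sval U)].
  case=> -[b|[j c]] _ <- /=; first by case: b; [apply: Or31|apply: Or32].
  case: pselect => [h|_]; last exact: Or31.
  apply: Or33; exists j; split=> p /=; first by left.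
  by case=> [|[]//]; apply: cut_mono.
have lat j j' (U V : up (comb m)) :
    between (l j) (sval U) -> between (l j') (sval V) ->
    range dec (hmeet U V) /\ range dec (hjoin U V).
  move=> bU bV.
  have sub (U' V' : up (comb m)) : (forall p, sval U' p -> sval V' p) ->
      hmeet U' V' = U' /\ hjoin U' V' = V'.
    move=> s; split; apply: up_eq => p /=; have := s p; tauto.
  have [lt|lt|e] := ltngtP (l j) (l j').
  - have [-> ->] := sub _ _ (between_sub lt bU bV).
    by split; [apply: rb bU|apply: rb bV].
  - have [h1 h2] := sub _ _ (between_sub lt bV bU).
    by rewrite hmeetC hjoinC h1 h2; split; [apply: rb bV|apply: rb bU].
  - rewrite -e in bV; move: bU bV => [U1 U2] [V1 V2].
    split; apply: (rb j); split=> p /=.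
    + by move=> cp; split; [apply: U1|apply: V1].
    + by case=> /U2.
    + by left; apply: U1.
    + by case=> [/U2|/V2].
exists dec => [|j]; last by apply: (rb j); have [] := hl j.
split=> // U V /dec_cases rU /dec_cases rV.
- case: rU => [->|->|[j bU]]; first by rewrite htopI; case: rV => [->|->|[j /rb]].
    by have -> : hmeet hbot V = hbot by apply: up_eq => p /=; tauto.
  case: rV => [->|->|[j' bV]]; first by rewrite hmeetC htopI; apply: rb bU.
    by have -> : hmeet U hbot = hbot by apply: up_eq => p /=; tauto.
  exact: (lat _ _ _ _ bU bV).1.
- case: rU => [->|->|[j bU]].
  + by have -> : hjoin htop V = htop by apply: up_eq => p /=; tauto.
  + by rewrite hbotU; case: rV => [->|->|[j /rb]].
  case: rV => [->|->|[j' bV]].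
  + by have -> : hjoin U htop = htop by apply: up_eq => p /=; tauto.
  + by rewrite hjoinC hbotU; apply: rb bU.
  exact: (lat _ _ _ _ bU bV).2.
- have impI j j' (U' V' : up (comb m)) : between (l j) (sval U') ->
      between (l j') (sval V') -> range dec (himp U' V').
    move=> bU bV; case: (between_imp (svalP U') (svalP V') (hl j).1 (hl j').1 bU bV).
    + by move=> h; have -> : himp U' V' = htop by apply: up_eq => p /=; have := h p.
    + exact: (rb _ (himp U' V')).
    + exact: (rb _ (himp U' V')).
  have topI (T : up (comb m)) : (forall p, sval T p) -> range dec T.
    by move=> hT; have -> : T = htop by apply: up_eq.
  case: rU => [->|->|[j bU]].
  + have -> : himp htop V = V.
      apply: up_eq => p /=; split=> [|Vp y py _]; last exact: (svalP V _ _ py).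
      by apply=> //; apply: comb_refl.
    by case: rV => [->|->|[j /rb]].
  + by apply: topI => p y.
  case: rV => [->|->|[j' bV]]; first by apply: topI => p y.
  (* Bottom belongs to the interval 0. If [U] lies in a higher interval, it contains the first
     antichain, of which every point sees a member, so its negation is bottom. *)
  + have [lj|lj] := posnP (l j).
      have b0 : between (l j) (sval (hbot : up (comb m))).
        by rewrite lj; split=> p //; rewrite /cut; lia.
      exact: impI bU b0.
    suff -> : himp U hbot = hbot by [].
    apply: up_eq => p; split=> //= H; have [U1 _] := bU.
    have c1 q : cut 1 q -> sval U q by move=> /(cut_mono lj) /U1.
    have [cp|ncp] := pselect (cut 1 p); first exact: (H p (comb_refl _ _) (c1 _ cp)).
    have c0 : cut 1 0 by left.
    exact: (H 0 (cut_sees ncp c0) (c1 _ c0)).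
  + exact: impI bU bV.
Qed.

End CombCuts.

Lemma combs_locally_finite (P : nat -> Prop) :
  locally_finite (models (fun e => forall m, P m -> satisfies (up (comb m)) e)).
Proof.
apply: models_locally_finite => k.
exists (bool + 'I_k * {ffun 'I_4 -> bool})%type => m v _.
exact: comb_finite_subalgebra.
Qed.

(** * A non-surjective epimorphism *)

(** In contrast to the combs, larger numbers lie higher, so there is no topmost antichain. *)
Definition stack_sees : rel nat := fun i j => (i == j) || (i %/ 2 < j %/ 2).

Lemma stack_refl : reflexive stack_sees.
Proof. by move=> i; rewrite /stack_sees eqxx. Qed.

Lemma stack_trans : transitive stack_sees.
Proof. by rewrite /stack_sees => j i k; lia. Qed.

Definition stack := Frame stack_refl stack_trans.
Definition chain := Frame leqnn leq_trans.

(** A nonempty upset of the stack contains all points from some antichain on. *)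
Lemma stack_upset_const (v : nat -> stack -> Prop) (t : hterm nat) N0 :
  (forall i, upset (v i)) ->
  exists2 N, N0 <= N & all_vars (fun i => forall x y : nat,
    2 * N <= x -> 2 * N <= y -> v i x <-> v i y) t.
Proof.
move=> hv.
pose P N i := forall x y : nat, 2 * N <= x -> 2 * N <= y -> v i x <-> v i y.
have Pmono N N' i : N <= N' -> P N i -> P N' i.
  by move=> NN' h x y ? ?; apply: h; lia.
suff [N hN] : exists N, all_vars (P N) t.
  exists (maxn N0 N); first exact: leq_maxl.
  by apply: sub_all_vars hN => i; apply: Pmono; apply: leq_maxr.
have two s u : (exists N, all_vars (P N) s) -> (exists N, all_vars (P N) u) ->
    exists N, all_vars (P N) s /\ all_vars (P N) u.
  move=> [N hN] [N' hN']; exists (maxn N N').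
  split; [apply: sub_all_vars hN|apply: sub_all_vars hN'] => i; apply: Pmono;
    [exact: leq_maxl|exact: leq_maxr].
elim: t => [i|s IHs u IHu|s IHs u IHu|s IHs u IHu||] /=;
  [|exact: two|exact: two|exact: two|by exists 0|by exists 0].
have [[x vx]|nx] := pselect (exists x, v i x); last first.
  by exists 0 => x y _ _; split=> h; case: nx; [exists x|exists y].
exists x.+1 => y z hy hz; split=> _; apply: hv vx => /=; rewrite /stack_sees; lia.
Qed.

(** Where the variables have become constant, the stack can be truncated; turned around by
    [2 * N + 1 - y], the remaining antichains are the topmost ones of a sufficiently large comb. *)
Lemma stack_satisfies e :
  (forall N, exists2 m, N <= m & satisfies (up (comb m)) e) ->
  satisfies (up stack) e.
Proof.
case: e => s t sat; apply/satisfies_upP => v hv x.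
have [N xN [/= hs ht]] := stack_upset_const (TMeet s t) x hv.
have [m Nm /satisfies_upP/= {}sat] := sat N.+1.
(* All points from [2 * N] on are also matched with both maximal points of the comb. *)
pose Z (y : stack) (j : comb m) := y + j = 2 * N + 1 \/ 2 * N <= y /\ j <= 1.
pose v' i (j : comb m) := j <= 2 * N + 1 /\ v i (2 * N + 1 - j).
have hv' i : upset (v' i).
  move=> j l /=; rewrite /comb_sees => jl [jN vj]; split; first by lia.
  by apply: hv vj => /=; rewrite /stack_sees; lia.
have forth y j y' : Z y j -> sees y y' -> exists2 j', sees j j' & Z y' j'.
  rewrite /Z /= /stack_sees /comb_sees => yj yy'.
  have [<-|ne] := eqVneq y y'; first by exists j => //; rewrite eqxx.
  have [h|h] := leqP y' (2 * N + 1); first by exists (2 * N + 1 - y'); lia.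
  by have [j1|j1] := leqP j 1; [exists j|exists 0]; lia.
have back y j j' : Z y j -> sees j j' -> exists2 y', sees y y' & Z y' j'.
  rewrite /Z /= /stack_sees /comb_sees => yj jj'.
  have [<-|ne] := eqVneq j j'; first by exists y => //; rewrite eqxx.
  by exists (2 * N + 1 - j'); lia.
have atoms r : all_vars (fun i => forall x y : nat,
    2 * N <= x -> 2 * N <= y -> v i x <-> v i y) r ->
  all_vars (fun i => forall y j, Z y j -> v i y <-> v' i j) r.
  apply: sub_all_vars => i h y j [yj|[hy hj]]; rewrite /v'.
    have -> : 2 * N + 1 - j = y by lia.
    by split=> [|[]//]; split=> //; lia.
  rewrite (h y (2 * N + 1 - j)) //; last by lia.
  by split=> [|[]//]; split=> //; lia.
have Zx : Z x (2 * N + 1 - x) by left; lia.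
rewrite (bisim_forces forth back (atoms _ hs) Zx).
rewrite (bisim_forces forth back (atoms _ ht) Zx).
exact: sat.
Qed.

(** Apart from that of 0, each fibre joins the odd point of one antichain to the even point of the
    next. *)
Definition roll (x : stack) : chain := x.+1 %/ 2.

Lemma roll_upset (U : chain -> Prop) : upset U -> @upset stack (fun x => U (roll x)).
Proof.
by move=> hU x y xy; apply: hU; move: xy; rewrite /= /stack_sees /roll; lia.
Qed.

Definition unroll (U : up chain) : up stack :=
  exist _ (fun x : stack => sval U (roll x)) (roll_upset (svalP U)).

Lemma unroll_hom : is_hom unroll.
Proof.
split=> *; apply: up_eq => z //=; split=> H y hy.
  by apply: H; move: hy; rewrite /stack_sees /roll; lia.
have [->|ne] := eqVneq y (roll z); first exact: (H z (stack_refl z)).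
(* A point [y] strictly above [roll z] lifts to [2 * y], which lies in a higher antichain than
   [z]. *)
have <- : roll (2 * y) = y by rewrite /roll; lia.
by apply: H; move: hy ne; rewrite /stack_sees /roll; lia.
Qed.

Lemma unroll_inj : injective unroll.
Proof.
move=> U V UV; apply: up_eq => n.
have e : roll (2 * n) = n by rewrite /roll; lia.
rewrite -[in X in X <-> _]e -[in X in _ <-> X]e.
by rewrite -[sval U _]/(sval (unroll U) _) UV.
Qed.

(** * An equation that makes the embedding an epimorphism *)

Section StepTerm.
Variable V : Type.
Implicit Types b c : hterm V.

(** In the stack, [b1] and [c1] arise from the meet of [b] and [c] by dropping one point each of its
    lowest antichain. The sequence of the [b] is to determine that of the [c]. *)
Definition step_term b c b1 c1 : hterm V :=
  TMeet (tiff (TMeet b c) (TJoin b1 c1))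
    (TMeet (tiff (TImp b1 c1) c1) (tiff (TImp c1 b1) b1)).

(** The uniqueness argument in a comb starts at index 0 or 1 and climbs twice, which takes the four
    steps from index 0 to 3. *)
Definition steps_term (b c : nat -> hterm V) : hterm V :=
  foldr (fun i t => TMeet (step_term (b i) (c i) (b i.+1) (c i.+1)) t) TTop
    (iota 0 4).

End StepTerm.

Arguments step_term : simpl never.
Arguments steps_term : simpl never.

Definition unique_term : hterm nat :=
  let b i := TVar (3 * i) in
  let c i := TVar (3 * i + 1) in
  let c' i := TVar (3 * i + 2) in
  TImp (TMeet (steps_term b c) (steps_term b c')) (TImp (c 1) (c' 1)).

Definition is_step (A : heyting) (b c b1 c1 : A) : Prop :=
  [/\ hmeet b c = hjoin b1 c1, himp b1 c1 = c1 & himp c1 b1 = b1].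

Lemma hmeetxx (A : heyting) (a : A) : hmeet a a = a.
Proof. by rewrite -[X in hmeet _ X](hmeetKU a a) hjoinKI. Qed.

Lemma heval_tiff V (A : heyting) (v : V -> A) s t :
  heval v s = heval v t -> heval v (tiff s t) = htop.
Proof.
by move=> /= ->; have /himp_eqT -> := hmeetxx (heval v t); rewrite hmeetxx.
Qed.

Lemma heval_step V (A : heyting) (v : V -> A) b c b1 c1 :
  is_step (heval v b) (heval v c) (heval v b1) (heval v c1) ->
  heval v (step_term b c b1 c1) = htop.
Proof.
move=> [h1 h2 h3].
have -> : heval v (step_term b c b1 c1) =
    hmeet (heval v (tiff (TMeet b c) (TJoin b1 c1)))
      (hmeet (heval v (tiff (TImp b1 c1) c1))
        (heval v (tiff (TImp c1 b1) b1))) by [].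
by rewrite !heval_tiff // !htopI.
Qed.

Lemma heval_steps V (A : heyting) (v : V -> A) b c :
  (forall i, is_step (heval v (b i)) (heval v (c i))
                     (heval v (b i.+1)) (heval v (c i.+1))) ->
  heval v (steps_term b c) = htop.
Proof.
move=> h; rewrite /steps_term; elim: (iota 0 4) => [//|i s IHs].
have heval_meet t u : heval v (TMeet t u) = hmeet (heval v t) (heval v u) by [].
by rewrite [foldr _ _ _]/= heval_meet IHs heval_step ?htopI.
Qed.

Lemma unique_term_step (A : heyting) (b c c' : nat -> A) :
  satisfies A (unique_term, TTop) ->
  (forall i, is_step (b i) (c i) (b i.+1) (c i.+1)) ->
  (forall i, is_step (b i) (c' i) (b i.+1) (c' i.+1)) ->
  forall n, hmeet (c n.+1) (c' n.+1) = c n.+1.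
Proof.
move=> sat hc hc' n.
(* The sequences are shifted by [n], as [unique_term] speaks of index 1; residues modulo 3 separate
   the three families. *)
pose v k := let i := n + k %/ 3 in
  if k %% 3 == 0 then b i else if k %% 3 == 1 then c i else c' i.
have vb i : v (3 * i) = b (n + i) by rewrite /v; case: ifP => [_|]; [congr b|]; lia.
have vc i : v (3 * i + 1) = c (n + i).
  by rewrite /v; case: ifP => [|_]; [lia|case: ifP => [_|]; [congr c|]; lia].
have vc' i : v (3 * i + 2) = c' (n + i).
  by rewrite /v; case: ifP => [|_]; [lia|case: ifP => [|_]; [|congr c']; lia].
have := sat v; rewrite /unique_term.
set s := steps_term _ _; set s' := steps_term _ _.
have -> : heval v (TImp (TMeet s s') (TImp (TVar (3 * 1 + 1)) (TVar (3 * 1 + 2)))) =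
  himp (hmeet (heval v s) (heval v s')) (himp (v (3 * 1 + 1)) (v (3 * 1 + 2))) by [].
rewrite !heval_steps; last 2 first.
- by move=> i /=; rewrite !vb !vc' addnS.
- by move=> i /=; rewrite !vb !vc addnS.
by rewrite hmeetxx himp_eqT htopI vc vc' addn1 himp_eqT.
Qed.

Section SemanticSteps.
Variables (W : frame) (z : W).

Definition forces_step (b c b1 c1 : W -> Prop) : Prop :=
  forall y, sees z y ->
  [/\ b y /\ c y <-> b1 y \/ c1 y,
      (forall k, sees y k -> b1 k -> c1 k) -> c1 y
    & (forall k, sees y k -> c1 k -> b1 k) -> b1 y].

Lemma forces_step_term V (v : V -> W -> Prop) b c b1 c1 :
  forces v (step_term b c b1 c1) z ->
  forces_step (forces v b) (forces v c) (forces v b1) (forces v c1).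
Proof.
move=> [[h1 h2] [[h3 _] [h4 _]]] y zy; split; [split| |].
- exact: h1.
- exact: h2.
- exact: h3.
- exact: h4.
Qed.

Lemma forces_steps_term V (v : V -> W -> Prop) b c i :
  forces v (steps_term b c) z -> i < 4 ->
  forces_step (forces v (b i)) (forces v (c i))
              (forces v (b i.+1)) (forces v (c i.+1)).
Proof.
move=> [h0 [h1 [h2 [h3 _]]]].
by case: i => [|[|[|[|//]]]] _; apply: forces_step_term.
Qed.

End SemanticSteps.

Section CombSteps.
Variables (m : nat) (z : comb m) (b c c' : nat -> comb m -> Prop).
Hypotheses (hb : forall i, upset (b i)) (hc : forall i, upset (c i)).
Hypothesis hc' : forall i, upset (c' i).
Hypothesis sc : forall i, i < 4 -> forces_step z (b i) (c i) (b i.+1) (c i.+1).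
Hypothesis sc' : forall i, i < 4 -> forces_step z (b i) (c' i) (b i.+1) (c' i.+1).

Let bad n a := [/\ b n a, ~ c' n a, c n.+1 a & ~ b n.+1 a].

(* Above a bad point there is another bad point, which is incomparable to a
   point properly seeing something it does not see; in a comb this only happens
   at one place. *)
Lemma bad_climbs n a : n < 3 -> sees z a -> bad n a ->
  [/\ bad n.+1 (2 * m + 1), sees a (2 * m + 1) & sees a (2 * m + 2)].
Proof.
move=> n3 za [bna nc'a ca nba]; have n4 : n.+1 < 4 := n3.
(* The point [a] sees [e] in [c' n.+1] outside of [b n.+1], and [a'] in [b n.+1] outside of
   [c' n.+1]; the latter is bad at the next index. Moreover [e] properly sees some [p] that [a']
   does not see, so [comb_incomparable] locates [e] and [a']. *)
have [_ _ /contra_not/(_ nba)] := sc' (ltnW n3) za.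
move=> /existsNP[e /not_implyP[ae /not_implyP[c'e nbe]]].
have nc'a1 : ~ c' n.+1 a.
  by move=> h; have [[_ /(_ (or_intror h))[]]] := sc' (ltnW n3) za.
have [_ /contra_not/(_ nc'a1) + _] := sc' (ltnW n3) za.
move=> /existsNP[a' /not_implyP[aa' /not_implyP[ba' nc'a']]].
have ze := sees_trans za ae; have za' := sees_trans za aa'.
have ca' : c n.+1 a' by apply: hc aa' ca.
have ce : c n.+1 e by apply: hc ae ca.
have nb2 : ~ b n.+2 a'.
  by move=> h; have [[_ /(_ (or_introl h))[]]] := sc' n4 za'.
have c2 : c n.+2 a'.
  by have [[/(_ (conj ba' ca'))[//|//]]] := sc n4 za'.
have nc2e : ~ c n.+2 e.
  by move=> h; have [[_ /(_ (or_intror h))[]]] := sc n4 ze.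
have [_ /contra_not/(_ nc2e) + _] := sc n4 ze.
move=> /existsNP[p /not_implyP[ep /not_implyP[b2p nc2p]]].
have bp : b n.+1 p.
  by have [[_ /(_ (or_introl b2p))[]]] := sc n4 (sees_trans ze ep).
have ne : p <> e by move=> h; rewrite h in bp.
have ea' : ~~ sees e a' by apply/negP => h; apply/nc'a'/(hc' h).
have a'e : ~~ sees a' e by apply/negP => h; apply/nbe/(hb h).
have a'p : ~~ sees a' p by apply/negP => h; apply/nc2p/(hc h).
have [eE a'E] : e = 2 * m + 2 /\ a' = 2 * m + 1.
  case: (comb_incomparable ea' a'e) => [[h1 h2 h3]|[h1 h2]|//];
    by move: ep a'p; rewrite /= /comb_sees; lia.
by rewrite -a'E -eE.
Qed.

(** Climbing a second time, now from [2 * m + 1], would make this point see [2 * m + 2]. *)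
Lemma not_bad n a : n < 2 -> sees z a -> ~ bad n a.
Proof.
move=> n2 za /(bad_climbs (ltnW n2) za)[h za1 _].
have [_ _] := bad_climbs (n2 : n.+1 < 3) (sees_trans za za1) h.
by rewrite /= /comb_sees; lia.
Qed.

(** A counterexample is bad at index 1 if it lies in [b 1], and at index 0 otherwise. *)
Lemma comb_unique a : sees z a -> c 1 a -> c' 1 a.
Proof.
move=> za c1; apply: contrapT => nc'1.
have [b1|nb1] := pselect (b 1 a).
- apply: (@not_bad 1 a) => //.
  have nb2 : ~ b 2 a.
    by move=> h; have [[_ /(_ (or_introl h))[]]] := sc' (isT : 1 < 4) za.
  by split=> //; have [[/(_ (conj b1 c1))[]]] := sc (isT : 1 < 4) za.
- apply: (@not_bad 0 a) => //.
  have [[_ /(_ (or_intror c1))[b0 c0]] _ _] := sc (isT : 0 < 4) za.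
  split=> // c'0.
  by have [[/(_ (conj b0 c'0))[]]] := sc' (isT : 0 < 4) za.
Qed.

End CombSteps.

Lemma comb_satisfies_unique m : satisfies (up (comb m)) (unique_term, TTop).
Proof.
apply/satisfies_upP => v hv x; split=> // _.
pose b i : hterm nat := TVar (3 * i).
suff H z : forces v (steps_term b (fun i => TVar (3 * i + 1))) z ->
    forces v (steps_term b (fun i => TVar (3 * i + 2))) z ->
    forall y, sees z y -> v (3 * 1 + 1) y -> v (3 * 1 + 2) y.
  by move=> z _ [h h'] y; apply: (H z h h' y).
move=> h h' y zy.
apply: (@comb_unique m z (fun i => v (3 * i)) (fun i => v (3 * i + 1))
  (fun i => v (3 * i + 2))) zy => i; try exact: hv.
- exact: (forces_steps_term h).
- exact: (forces_steps_term h').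
Qed.

(** Besides all antichains from the [n]-th on, [stack_b n] has the odd and [stack_c n] the even
    point of the preceding one; for [n = 0] both are everything. The former are preimages under
    [roll]. *)
Lemma stack_b_upset n : @upset stack (fun x => 2 * n <= x.+1).
Proof. by move=> x y /=; rewrite /stack_sees; lia. Qed.

Lemma stack_c_upset n :
  @upset stack (fun x => 2 * n <= x \/ x.+2 = 2 * n).
Proof. by move=> x y /=; rewrite /stack_sees; lia. Qed.

Definition stack_b n : up stack := exist _ _ (@stack_b_upset n).
Definition stack_c n : up stack := exist _ _ (@stack_c_upset n).

Lemma stack_step n :
  is_step (stack_b n) (stack_c n) (stack_b n.+1) (stack_c n.+1).
Proof.
split; apply: up_eq => x /=; first by lia.
- split=> [H|H y]; last by move: H; rewrite /stack_sees; lia.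
  apply: contrapT => nx.
  have := H (2 * n).+1; rewrite /stack_sees => H1.
  suff : 2 * n.+1 <= (2 * n).+1 \/ (2 * n).+3 = 2 * n.+1 by lia.
  by apply: H1; lia.
- split=> [H|H y]; last by move: H; rewrite /stack_sees; lia.
  apply: contrapT => nx.
  have := H (2 * n); rewrite /stack_sees => H1.
  suff : 2 * n.+1 <= (2 * n).+1 by lia.
  by apply: H1; lia.
Qed.

(** An upset is determined by its least element [x] and, if [x] is even, by whether it contains
    [x + 1]. *)
Lemma stack_cases (U : up stack) :
  [\/ U = hbot, exists n, U = stack_b n, exists n, U = stack_c n
    | exists n, U = hmeet (stack_b n) (stack_c n)].
Proof.
have [[x Ux]|nU] := pselect (exists x, sval U x); last first.
  by apply: Or41; apply: up_eq => x; split=> // Ux; case: nU; exists x.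
have exP : exists x, `[< sval U x >] by exists x; apply/asboolP.
case: (ex_minnP exP) => {x exP}{}x /asboolP{}Ux xmin.
have lo y : sval U y -> x <= y by move=> Uy; apply/xmin/asboolP.
have hi (y : nat) : x %/ 2 < y %/ 2 -> sval U y.
  by move=> xy; apply: (svalP U) Ux; rewrite /= /stack_sees; lia.
have Ueq (y : nat) : y = x -> sval U y by move=> ->.
have [xo|xe] := boolP (odd x).
  apply: Or42; exists (x.+1 %/ 2); apply: up_eq => y /=; split=> [/lo|h].
    by lia.
  by have [/Ueq//|ne] := eqVneq y x; apply: hi; lia.
have [U1|nU1] := pselect (sval U x.+1).
- apply: Or44; exists (x %/ 2); apply: up_eq => y /=; split=> [/lo|h]; first by lia.
  have [/Ueq//|ne] := eqVneq y x; have [->//|ne'] := eqVneq y x.+1.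
  by apply: hi; lia.
- apply: Or43; exists (x %/ 2).+1; apply: up_eq => y /=; split=> [Uy|h].
    have := lo _ Uy; have ne : y <> x.+1 by move=> e; rewrite -e in nU1.
    by lia.
  by have [/Ueq//|ne] := eqVneq y x; apply: hi; lia.
Qed.

(** The maps [g] and [h] agree on every [stack_b n], and the images of the [stack_c n] under both
    satisfy the step relations over this common sequence. Uniqueness, used in both directions,
    identifies them from index 1 on; [stack_c 0] is top. *)
Lemma unroll_epimorphism K :
  (forall A, K A -> satisfies A (unique_term, TTop)) -> epimorphism K unroll.
Proof.
move=> hK; split=> [|C g h KC gh hh gf]; first exact: unroll_hom.
have cut_upset n : @upset chain (fun x => n <= x).
  by move=> x y /= xy nx; apply: leq_trans xy.
have bE n : g (stack_b n) = h (stack_b n).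
  have -> : stack_b n = unroll (exist _ _ (cut_upset n)).
    by apply: up_eq => x /=; rewrite /roll; lia.
  exact: (congr1 (@^~ _) gf).
have hom_step (k : up stack -> C) : is_hom k -> forall n,
    is_step (k (stack_b n)) (k (stack_c n)) (k (stack_b n.+1)) (k (stack_c n.+1)).
  move=> [kM kJ kI _ _] n; have [h1 h2 h3] := stack_step n.
  by split; rewrite -?kM -?kJ -?kI ?h1 ?h2 ?h3.
have sg := hom_step g gh; have sh := hom_step h hh.
have sh' i : is_step (g (stack_b i)) (h (stack_c i))
    (g (stack_b i.+1)) (h (stack_c i.+1)).
  by rewrite !bE.
have le1 := unique_term_step (hK _ KC) sg sh'.
have le2 := unique_term_step (hK _ KC) sh' sg.
have cE n : g (stack_c n) = h (stack_c n).
  case: n => [|n]; last by rewrite -le1 hmeetC le2.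
  have -> : stack_c 0 = htop by apply: up_eq => x /=; split=> // _; left.
  by case: gh hh => _ _ _ _ -> [].
case: gh hh => gM _ _ g0 _ [hM _ _ h0 _]; apply/funext => U.
case: (stack_cases U) => [->|[n ->]|[n ->]|[n ->]].
- by rewrite g0 h0.
- exact: bE.
- exact: cE.
- by rewrite gM hM bE cE.
Qed.

(** The upset [stack_c 1] contains 2 but not 1, although [roll] identifies these points. *)
Lemma unroll_not_surjective : ~ forall b, exists a, unroll a = b.
Proof.
move=> /(_ (stack_c 1)) [a ha].
have E x : sval a (roll x) <-> 2 <= x \/ x.+2 = 2.
  by rewrite -[sval a _]/(sval (unroll a) x) ha.
have /E : sval a (roll 1) by apply/(E 2); left.
by lia.
Qed.

Lemma combs_not_ES (P : nat -> Prop) :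
  (forall N, exists2 m, N <= m & P m) ->
  ~ ES_property (models (fun e => forall m, P m -> satisfies (up (comb m)) e)).
Proof.
move=> hP ES; apply: unroll_not_surjective.
have stack_in e : (forall m, P m -> satisfies (up (comb m)) e) ->
    satisfies (up stack) e.
  move=> he; apply: stack_satisfies => N; have [m Nm Pm] := hP N.
  by exists m => //; apply: he.
apply: ES => [e he|e he|].
- exact: satisfies_sub unroll_hom unroll_inj (stack_in e he).
- exact: stack_in.
- by apply: unroll_epimorphism => A; apply=> m _; apply: comb_satisfies_unique.
Qed.

(** * Counting *)

Fixpoint term_tree (t : hterm nat) : GenTree.tree nat :=
  match t with
  | TVar i => GenTree.Leaf i
  | TMeet s u => GenTree.Node 0 [:: term_tree s; term_tree u]
  | TJoin s u => GenTree.Node 1 [:: term_tree s; term_tree u]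
  | TImp s u => GenTree.Node 2 [:: term_tree s; term_tree u]
  | TBot => GenTree.Node 3 [::]
  | TTop => GenTree.Node 4 [::]
  end.

Lemma term_tree_inj : injective term_tree.
Proof.
by elim=> [i|s IHs u IHu|s IHs u IHu|s IHs u IHu||] [j|s' u'|s' u'|s' u'||] //= [];
  [move=> ->|move=> /IHs-> /IHu->..].
Qed.

Definition equation_code (e : equation) : nat :=
  pickle (term_tree e.1, term_tree e.2).

Lemma equation_code_inj : injective equation_code.
Proof.
move=> [s t] [s' t'] /(pcan_inj pickleK)[].
by move=> /term_tree_inj-> /term_tree_inj->.
Qed.

(** Exactly one of [2 * i] and [2 * i + 1] is selected for each [i], so that every [s] yields an
    infinite set of combs. *)
Definition selected (s : nat -> bool) (m : nat) : Prop := s (m %/ 2) = odd m.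

Lemma selected_unbounded s N : exists2 m, N <= m & selected s m.
Proof.
exists (2 * N + s N); first by lia.
have e : (2 * N + s N) %/ 2 = N by case: (s N); lia.
by rewrite /selected e oddD oddM /= oddb.
Qed.

Definition comb_theory (P : nat -> Prop) : set equation :=
  fun e => forall m, P m -> satisfies (up (comb m)) e.

Lemma comb_theory_closed P : comb_theory P = theory (models (comb_theory P)).
Proof.
apply/funext => e; apply/propext; split=> [he A|he m Pm]; first exact.
by apply: he => e'; apply.
Qed.

Lemma selected_comb_theory_inj :
  injective (fun s => comb_theory (selected s)).
Proof.
move=> s s' E; apply/funext => i; apply: contrapT => ne.
pose n := 2 * i + s i.
have e : n %/ 2 = i by rewrite /n; case: (s i); lia.
have sn : selected s n by rewrite /selected e /n oddD oddM /= oddb.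
apply: (@comb_not_satisfies n).
have : comb_theory (selected s') (comb_equation n).
  move=> m sm; apply: comb_satisfies => mn; apply: ne.
  by rewrite mn in sm; move: sn sm; rewrite /selected e => -> ->.
by rewrite -E => /(_ n sn).
Qed.

Definition lf_nonES (RN : heyting) (K : heyting -> Prop) : Prop :=
  [/\ is_variety K, subclass K (variety_gen RN),
      locally_finite K & ~ ES_property K].

Lemma comb_theory_nonES (RN : heyting) (x : RN) s :
  free_on x -> lf_nonES RN (models (comb_theory (selected s))).
Proof.
move=> RN_free; split.
- exact: models_variety.
- move=> A mA K [E KE] /KE RNE; apply/KE => e Ee; apply: mA => m _.
  exact: RN_satisfies_comb RN_free (RNE e Ee).
- exact: combs_locally_finite.
- by apply: combs_not_ES => N; apply: selected_unbounded.
Qed.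

Local Open Scope card_scope.

(** Closed theories stand for varieties, with which they correspond bijectively by [varietyP]. The
    sets of selected combs give the lower bound, characteristic functions on codes of equations the
    upper one. *)
Lemma theories_card (RN : heyting) (x : RN) : free_on x ->
  [set: nat -> bool] #=
  [set T | lf_nonES RN (models T) /\ T = theory (models T)].
Proof.
move=> RN_free; set D := [set T | _].
rewrite card_eq_le; apply/andP; split.
- pose G s := comb_theory (selected s).
  have GI : {in [set: nat -> bool] &, injective G}.
    by move=> s s' _ _; apply: selected_comb_theory_inj.
  rewrite -(card_le_eql (inj_card_eq GI)); apply: subset_card_le => _ [s _ <-].
  by split; [apply: comb_theory_nonES RN_free|apply: comb_theory_closed].
- apply/pcard_injP.
  exists (fun (T : set equation) n => `[< exists2 e, T e & equation_code e = n >]).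
  move=> T T' _ _ E; apply/funext => e; apply/propext.
  have sub (T1 T2 : set equation) :
      (fun n => `[< exists2 e, T1 e & equation_code e = n >]) =
      (fun n => `[< exists2 e, T2 e & equation_code e = n >]) -> T1 e -> T2 e.
    move=> /(congr1 (@^~ (equation_code e))) E1 T1e.
    have /asboolP : `[< exists2 e', T2 e' & equation_code e' = equation_code e >].
      by rewrite -E1; apply/asboolP; exists e.
    by case=> e' + /equation_code_inj <-.
  by split; apply: sub.
Qed.

Theorem theorem8p4 (RN : heyting) (x : RN) (RN_free : free_on x) :
  exists F : (nat -> bool) -> (heyting -> Prop),
    injective F /\
    forall K : heyting -> Prop,
      [/\ is_variety K, subclass K (variety_gen RN),
          locally_finite K & ~ ES_property K]
      <-> exists s : nat -> bool, F s = K.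
Proof.
have /card_set_bijP[f [fD fI fS]] := theories_card RN_free.
exists (fun s => models (f s)); split=> [s s' E|K].
  apply: (fI s s'); rewrite ?inE //.
  have [_ ->] := fD s I; have [_ ->] := fD s' I.
  by rewrite E.
split=> [gK|[s <-]]; last by have [] := fD s I.
have vK : is_variety K by case: gK.
have [|s _ fs] := fS (theory K); last by exists s; rewrite fs -varietyP.
by rewrite /= -varietyP.
Qed.
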